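(* The GInexPM with Armijo search (as described in the context) either finishes in a finite number of iterations at a stationary point of the problem $\min\{f(x):x\in C\}$, or generates an infinite sequence $(x^k)_{k\in\mathbb{N}}$ for which $(f(x^k))_{k\in\mathbb{N}}$ is a (strictly) decreasing sequence and every cluster point of $(x^k)_{k\in\mathbb{N}}$ is stationary for this problem.
   Context: Setting. $C\subset\mathbb{R}^n$ is a nonempty closed convex set and $f:\mathbb{R}^n\to\mathbb{R}$ is continuously differentiable; $\langle\cdot,\cdot\rangle$ and $\|\cdot\|$ are the Euclidean inner product and norm; $\mathbb{N}=\{0,1,2,\dots\}$. A point $\bar x\in C$ is stationary if $\langle\nabla f(\bar x),x-\bar x\rangle\ge 0$ for all $x\in C$. Inexact projection. For each $\gamma_3\ge 0$, $\varphi_{\gamma_3}:\mathbb{R}^n\times\mathbb{R}^n\to[0,\infty)$ is a function with $\varphi_{\gamma_3}(u,w)\le\gamma_3\|w-u\|^2$ for all $u,w$, and the map $(\gamma_3,u,w)\mapsto\varphi_{\gamma_3}(u,w)$ is continuous. For $u\in C$, $v\in\mathbb{R}^n$, $\mathcal{P}_C(\varphi_{\gamma_3},u,v):=\{w\in C:\langle v-w,y-w\rangle\le\varphi_{\gamma_3}(u,w)\ \forall y\in C\}$. GInexPM with Armijo search. Fix $\sigma,\tau\in(0,1)$, $0<\alpha_{\min}\le\alpha_{\max}$, $\bar\gamma<1/2$, and $x^0\in C$. At iteration $k$: choose reals $\alpha_k,\gamma_3^k$ with $\alpha_{\min}\le\alpha_k\le\alpha_{\max}$ and $0\le\gamma_3^k\le\bar\gamma$,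 set $z^k:=x^k-\alpha_k\nabla f(x^k)$ and take any $w^k\in\mathcal{P}_C(\varphi_{\gamma_3^k},x^k,z^k)$. If $w^k=x^k$, stop (finishing at $x^k$). Otherwise set $\tau_k:=\tau^{j_k}$ with $j_k:=\min\{j\in\mathbb{N}: f(x^k+\tau^j(w^k-x^k))\le f(x^k)+\sigma\tau^j\langle\nabla f(x^k),w^k-x^k\rangle\}$ and $x^{k+1}:=x^k+\tau_k(w^k-x^k)$. *)

(* Defs.v *)
(* MathComp / MathComp-Analysis *)
From HB Require Import structures.
From mathcomp Require Import all_boot all_order all_algebra.
From mathcomp Require Import all_classical all_reals all_analysis.

Set Implicit Arguments.
Unset Strict Implicit.
Unset Printing Implicit Defensive.

Import Order.TTheory GRing.Theory Num.Theory.
Import numFieldNormedType.Exports.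

Local Open Scope classical_set_scope.
Local Open Scope ring_scope.

(* The norm that MathComp-Analysis puts on 'rV[R]_n is the sup norm. It gives
   the usual topology and the usual Frechet differentiability, but metric
   quantities have to use [enorm]. *)
Definition dotp (R : realType) (n : nat) (u v : 'rV[R]_n) : R :=
  (u *m v^T) 0 0.

Definition enorm (R : realType) (n : nat) (u : 'rV[R]_n) : R :=
  Num.sqrt (dotp u u).

Definition grad (R : realType) (n : nat) (f : 'rV[R]_n -> R) (x : 'rV[R]_n) :
    'rV[R]_n :=
  \row_i 'D_(delta_mx 0 i) f x.

Definition continuously_differentiable (R : realType) (n : nat)
    (f : 'rV[R]_n -> R) : Prop :=
  (forall x, differentiable f x) /\ continuous (grad f).

Definition stationary (R : realType) (n : nat) (C : set 'rV[R]_n)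
    (f : 'rV[R]_n -> R) : set 'rV[R]_n :=
  [set xbar | C xbar /\ forall x, C x -> 0 <= dotp (grad f xbar) (x - xbar)].

(* [phi g] stands for varphi_{gamma_3} at gamma_3 = g. Only g >= 0 is
   meaningful; the values of [phi] at negative g are left unconstrained. *)
Definition error_tolerance (R : realType) (n : nat)
    (phi : R -> 'rV[R]_n -> 'rV[R]_n -> R) : Prop :=
  (forall g u w, 0 <= g -> 0 <= phi g u w <= g * enorm (w - u) ^+ 2) /\
  {within [set p : R * 'rV[R]_n * 'rV[R]_n | 0 <= p.1.1],
    continuous (fun p : R * 'rV[R]_n * 'rV[R]_n => phi p.1.1 p.1.2 p.2)}.

Definition inexact_proj (R : realType) (n : nat) (C : set 'rV[R]_n)
    (phi : 'rV[R]_n -> 'rV[R]_n -> R) (u v : 'rV[R]_n) : set 'rV[R]_n :=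
  [set w | C w /\ forall y, C y -> dotp (v - w) (y - w) <= phi u w].

Definition armijo (R : realType) (n : nat) (f : 'rV[R]_n -> R)
    (sigma tau : R) (x w : 'rV[R]_n) (j : nat) : Prop :=
  f (x + tau ^+ j *: (w - x)) <=
    f x + sigma * tau ^+ j * dotp (grad f x) (w - x).

Definition armijo_index (R : realType) (n : nat) (f : 'rV[R]_n -> R)
    (sigma tau : R) (x w : 'rV[R]_n) (j : nat) : Prop :=
  armijo f sigma tau x w j /\
  forall i, armijo f sigma tau x w i -> (j <= i)%N.

Record ginexpm_params (R : realType) : Type := GInexPMParams {
  sigma : R;
  tau : R;
  alpha_min : R;
  alpha_max : R;
  gamma_bar : R
}.

Definition valid_params (R : realType) (p : ginexpm_params R) : Prop :=
  [/\ 0 < sigma p < 1, 0 < tau p < 1,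
      0 < alpha_min p, alpha_min p <= alpha_max p & gamma_bar p < 2^-1].

Definition admissible (R : realType) (p : ginexpm_params R) (alpha g : R) :
    Prop :=
  alpha_min p <= alpha <= alpha_max p /\ 0 <= g <= gamma_bar p.

(* The set from which w^k is taken, at x = x^k. *)
Definition candidates (R : realType) (n : nat) (C : set 'rV[R]_n)
    (f : 'rV[R]_n -> R) (phi : R -> 'rV[R]_n -> 'rV[R]_n -> R)
    (alpha g : R) (x : 'rV[R]_n) : set 'rV[R]_n :=
  inexact_proj C (phi g) x (x - alpha *: grad f x).

Definition ginexpm_step (R : realType) (n : nat) (C : set 'rV[R]_n)
    (f : 'rV[R]_n -> R) (phi : R -> 'rV[R]_n -> 'rV[R]_n -> R)
    (p : ginexpm_params R) (alpha g : R) (x w x' : 'rV[R]_n) : Prop :=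
  [/\ admissible p alpha g, candidates C f phi alpha g x w, w <> x &
      exists2 j, armijo_index f (sigma p) (tau p) x w j &
                 x' = x + tau p ^+ j *: (w - x)].

(* The possible fates of an execution. [Breakdown N] is the case where
   iteration N cannot be carried out: the inexact projection set is empty, or
   no exponent satisfies the Armijo inequality. That it never occurs is part
   of the claim that a run either stops or is infinite. *)
Variant outcome : Type :=
  | Finishes of nat
  | Infinite
  | Breakdown of nat.

(* x, alpha, gam, w record the iterates and the choices made; when the run
   has only finitely many iterations, their later values are irrelevant. *)
Definition ginexpm_run (R : realType) (n : nat) (C : set 'rV[R]_n)
    (f : 'rV[R]_n -> R) (phi : R -> 'rV[R]_n -> 'rV[R]_n -> R)
    (p : ginexpm_params R) (x0 : 'rV[R]_n) (o : outcome)
    (x : nat -> 'rV[R]_n) (alpha gam : nat -> R) (w : nat -> 'rV[R]_n) :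
    Prop :=
  let step k :=
    ginexpm_step C f phi p (alpha k) (gam k) (x k) (w k) (x k.+1) in
  let W k := candidates C f phi (alpha k) (gam k) (x k) in
  x 0%N = x0 /\
  match o with
  | Finishes N =>
      [/\ forall k, (k < N)%N -> step k, admissible p (alpha N) (gam N),
          W N (w N) & w N = x N]
  | Infinite => forall k, step k
  | Breakdown N =>
      [/\ forall k, (k < N)%N -> step k, admissible p (alpha N) (gam N) &
          W N = set0 \/
          [/\ W N (w N), w N <> x N &
              forall j, ~ armijo f (sigma p) (tau p) (x N) (w N) j]]
  end.

(* Main.v *)
Require Import Defs.
From HB Require Import structures.
From mathcomp Require Import all_boot all_order all_algebra.
From mathcomp Require Import all_classical all_reals all_analysis.

From mathcomp Require Import ring lra.
Set Implicit Arguments.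
Unset Strict Implicit.
Unset Printing Implicit Defensive.

Import Order.TTheory GRing.Theory Num.Theory.
Import numFieldNormedType.Exports.

Local Open Scope classical_set_scope.
Local Open Scope ring_scope.

(** Write d = w - x for the direction found at x and g for the gradient of f
    at x. The tolerance is at most half of ||d||^2, so the inequality defining
    the inexact projection reads
      - <d, y - w> - alpha <g, y - w> <= ||d||^2 / 2   for all y in C,
    which is [near_projection]; everything about the method is deduced from it.

    Taking y = x gives alpha <g, d> <= - ||d||^2 / 2. Hence d is a descent
    direction unless w = x, and ||d|| <= 2 alpha ||g||. If w = x, then d = 0
    and the inequality is stationarity of x. An exact projection is always a
    candidate, and a backtracking search along a descent direction ends, so no
    iteration breaks down, and each of them strictly decreases f.

    For a cluster point xbar, choose a filter on the indices, finer than the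
    tails, along which x^k tends to xbar; the bound on d^k allows refining it
    so that d^k tends to some dbar as well. If dbar = 0, then w^k tends to xbar
    and the inequality above, divided by alpha_k >= alpha_min, passes to the
    limit and says that xbar is stationary ([near_projection_vi]). So all comes
    down to dbar = 0 ([directions_vanish]). Were it false, the slope
    <grad f xbar, dbar> would be negative, and continuity of the gradient would
    make the Armijo inequality hold with the same threshold delta on the steps
    for all (x, d) near (xbar, dbar) ([armijo_near]). The accepted steps would
    then be bounded below by some c > 0 ([armijo_index_large]), so that
      f xbar <= f x^(k+1) <= f x^k + sigma c <grad f x^k, d^k>,
    whose limit f xbar <= f xbar + sigma c <grad f xbar, dbar> is absurd. *)

(** * The Euclidean inner product on row vectors *)

Section Dotp.
Context {R : realType} {n : nat}.
Implicit Types u v w : 'rV[R]_n.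

Lemma dotpE u v : dotp u v = \sum_i u 0 i * v 0 i.
Proof. by rewrite /dotp mxE; apply: eq_bigr => i _; rewrite mxE. Qed.

Lemma dotpC u v : dotp u v = dotp v u.
Proof. by rewrite !dotpE; apply: eq_bigr => i _; rewrite mulrC. Qed.

Lemma dotpDl u v w : dotp (u + v) w = dotp u w + dotp v w.
Proof. by rewrite /dotp mulmxDl mxE. Qed.

Lemma dotpZl a u v : dotp (a *: u) v = a * dotp u v.
Proof. by rewrite /dotp -scalemxAl mxE. Qed.

Lemma dotpDr u v w : dotp u (v + w) = dotp u v + dotp u w.
Proof. by rewrite dotpC dotpDl !(dotpC u). Qed.

Lemma dotpZr a u v : dotp u (a *: v) = a * dotp u v.
Proof. by rewrite dotpC dotpZl dotpC. Qed.

Lemma dotpNl u v : dotp (- u) v = - dotp u v.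
Proof. by rewrite -scaleN1r dotpZl mulN1r. Qed.

Lemma dotpNr u v : dotp u (- v) = - dotp u v.
Proof. by rewrite dotpC dotpNl dotpC. Qed.

Definition dotp_lin := (dotpDl, dotpDr, dotpNl, dotpNr, dotpZl, dotpZr).

Lemma dotp0 u : dotp 0 u = 0.
Proof. by rewrite /dotp mul0mx mxE. Qed.

Lemma dotp_ge0 u : 0 <= dotp u u.
Proof. by rewrite dotpE sumr_ge0// => i _; rewrite -expr2 sqr_ge0. Qed.

Lemma dotp_eq0 u : (dotp u u == 0) = (u == 0).
Proof.
rewrite dotpE psumr_eq0 => [|i _]; last by rewrite -expr2 sqr_ge0.
apply/allP/eqP => [u0|-> i _]; last by rewrite !mxE mulr0 eqxx.
apply/rowP => i; rewrite mxE.
by have := u0 i (mem_index_enum i); rewrite -expr2 sqrf_eq0 => /eqP.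
Qed.

Lemma dotp_gt0 u : u != 0 -> 0 < dotp u u.
Proof. by rewrite lt_def dotp_ge0 dotp_eq0 andbT. Qed.

Lemma enorm_sqr u : enorm u ^+ 2 = dotp u u.
Proof. by rewrite sqr_sqrtr ?dotp_ge0. Qed.

Lemma sqr_coord_le u i : u 0 i ^+ 2 <= dotp u u.
Proof.
rewrite dotpE (bigD1 i)//= -expr2 lerDl sumr_ge0// => j _.
by rewrite -expr2 sqr_ge0.
Qed.

Lemma cvg_dotp (T : Type) (F : set_system T) {FF : Filter F}
    (g h : T -> 'rV[R]_n) u v :
  g @ F --> u -> h @ F --> v -> dotp (g t) (h t) @[t --> F] --> dotp u v.
Proof.
move=> gu hv; rewrite dotpE.
under eq_fun do rewrite dotpE.
apply: cvg_big => [|i _]; first exact: add_continuous.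
have coord (k : T -> 'rV[R]_n) (a : 'rV[R]_n) :
    k @ F --> a -> k t 0 i @[t --> F] --> a 0 i.
  move=> ka; apply: (@cvg_comp _ _ _ k (fun m : 'rV[R]_n => m 0 i) _ (nbhs a)).
    exact: ka.
  exact: coord_continuous.
by apply: cvgM; exact: coord.
Qed.

Lemma sqdist_continuous v : continuous (fun u => dotp (u - v) (u - v)).
Proof.
move=> u; have uv : (fun t => t - v) @ u --> u - v.
  by apply: (@cvgB _ _ _ (nbhs u) _ idfun (cst v) u v) => //; exact: cvg_cst.
exact: (cvg_dotp uv uv).
Qed.

Lemma closed_dotp_ball v (M : R) :
  closed [set u | dotp (u - v) (u - v) <= M].
Proof.
apply: (@preimage_closed _ _ (fun u => dotp (u - v) (u - v)) [set r | r <= M]).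
  by move=> u _; exact: sqdist_continuous.
exact: closed_le.
Qed.

(** Euclidean balls are bounded for the sup norm because each coordinate is at
    most the Euclidean norm. *)
Lemma compact_dotp_ball v (M : R) :
  compact [set u | dotp (u - v) (u - v) <= M].
Proof.
apply: bounded_closed_compact.
  apply: (@filterS _ _ _ _ _ _ (nbhs_pinfty_ge (num_real (`|v| + (M + 1))))).
  move=> r rM u /= uM; apply: le_trans rM.
  rewrite -[in leLHS](subrK v u) (le_trans (ler_normD _ _))// addrC lerD2l.
  have M0 : 0 <= M by exact: le_trans (dotp_ge0 _) uM.
  rewrite [leLHS]/Num.Def.normr/= mx_normrE.
  apply: bigmax_le => [|[i j] _ /=]; first by rewrite addr_ge0.
  rewrite ord1; have := le_trans (sqr_coord_le (u - v) j) uM.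
  rewrite -real_normK ?num_real//; set c := `|_|.
  (* If c ^ 2 <= M then c <= c ^ 2 + 1 / 4 <= M + 1. *)
  by move=> cM; have := sqr_ge0 (c - 2^-1); nra.

exact: closed_dotp_ball.
Qed.

End Dotp.

(** * Projection onto a closed convex set *)

Lemma convex_segment (R : realType) (n : nat) (C : set 'rV[R]_n)
    (x y : 'rV[R]_n) (t : R) :
  @convex_set R 'rV[R]_n C -> C x -> C y -> 0 <= t <= 1 ->
  C (x + t *: (y - x)).
Proof.
move=> Cconv Cx Cy /andP[t0 t1].
have /= := Cconv y x (@Itv01 R t t0 t1) (mem_set Cy) (mem_set Cx).
move=> /set_mem; congr (C _).
by apply/rowP => i; rewrite /conv/= /unstable.onem !mxE; ring.
Qed.

(** The point w of C nearest to v: moving from w towards y by a fraction t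
    changes the squared distance to v by - 2 t <v - w, y - w> + t^2 ||y - w||^2,
    which would be negative for small t if the inner product were positive. *)
Lemma projection_exists (R : realType) (n : nat) (C : set 'rV[R]_n)
    (v : 'rV[R]_n) :
  C !=set0 -> closed C -> @convex_set R 'rV[R]_n C ->
  exists2 w, C w & forall y, C y -> dotp (v - w) (y - w) <= 0.
Proof.
move=> [c Cc] Ccl Cconv.
pose q u := dotp (u - v) (u - v).
have q_cont : continuous q by exact: sqdist_continuous.
have Kcpt : compact (C `&` [set u | q u <= q c]).
  apply: subclosed_compact (@compact_dotp_ball R n v (q c)) _;
    last exact: subIsetr.
  by apply: closedI => //; exact: closed_dotp_ball.
have [||w] := @EVT_min_rV R n q _ _ Kcpt.
- by exists c; split => /=.
- exact: continuous_subspaceT.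
rewrite inE => -[Cw wc] wmin.
have w_best u : C u -> q w <= q u.
  move=> Cu; have [uc|/ltW cu] := leP (q u) (q c); last exact: le_trans cu.
  by apply: wmin; rewrite inE.
exists w => // y Cy; rewrite leNgt; apply/negP => a0.
set a := dotp _ _ in a0; pose b := dotp (y - w) (y - w).
have b0 : 0 <= b by exact: dotp_ge0.
have expand t : q (w + t *: (y - w)) = q w - 2 * t * a + t ^+ 2 * b.
  rewrite /q /a /b; have -> : w + t *: (y - w) - v = t *: (y - w) - (v - w).
    by rewrite opprB addrA [t *: _ + w]addrC.
  rewrite -[w - v]opprB !dotp_lin.
  by rewrite (dotpC w v) (dotpC y v) (dotpC y w); ring.
(* The minimizer a / b of the quadratic is undefined when b = 0 and may exceed
   1; this smaller fraction avoids both and still makes it negative. *)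
pose t := a / (a + b).
have ab0 : 0 < a + b by lra.
have tab : t * (a + b) = a by rewrite divfK// gt_eqF.
have t01 : 0 < t <= 1.
  by rewrite divr_gt0//= ler_pdivrMr// mul1r lerDl.
have := w_best _ (@convex_segment R n C w y t Cconv Cw Cy _).
rewrite expand.
case/andP: t01 => t0 t1.
rewrite (ltW t0) t1 => /(_ isT).
by nra.
Qed.

(** * Armijo's inequality *)

Lemma derive_dotp_grad (R : realType) (n : nat) (f : 'rV[R]_n -> R) x d :
  differentiable f x -> 'D_d f x = dotp (grad f x) d.
Proof.
move=> fx; rewrite deriveE// {1}[d]row_sum_delta linear_sum dotpE.
by apply: eq_bigr => i _; rewrite linearZ mxE deriveE// mulrC.
Qed.

Lemma is_derive_line (R : realType) (n : nat) (f : 'rV[R]_n -> R) x d (t : R) :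
  differentiable f (x + t *: d) ->
  is_derive t 1 (fun s => f (x + s *: d)) (dotp (grad f (x + t *: d)) d).
Proof.
move=> fx.
have quot :
    (fun h : R => h^-1 *: (f (x + (h *: 1 + t) *: d) - f (x + t *: d))) =
    (fun h : R => h^-1 *: (f (h *: d + (x + t *: d)) - f (x + t *: d))).
  by apply/funext => h; rewrite [h *: 1]mulr1 scalerDl addrCA.
apply: DeriveDef.
  by rewrite /derivable /= quot; exact: diff_derivable.
by rewrite -derive_dotp_grad// /derive /= quot.
Qed.

(** The threshold delta on the step lengths is uniform in a neighbourhood of
    (x, d). By the mean value theorem the increment of f along s d is s times a
    slope at an intermediate point, and by continuity that slope stays below
    sigma times the initial one, since this is so at (x, d) with a zero step. *)
Lemma armijo_near (R : realType) (n : nat) (f : 'rV[R]_n -> R)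
    (sigma : R) (x d : 'rV[R]_n) :
  continuously_differentiable f -> sigma < 1 -> dotp (grad f x) d < 0 ->
  exists2 delta : R, 0 < delta &
    \forall z \near (x, d), forall s : R, 0 < s < delta ->
      f (z.1 + s *: z.2) <= f z.1 + sigma * s * dotp (grad f z.1) z.2.
Proof.
move=> [f_diff grad_cont] sigma1 gd0.
pose h (q : ('rV[R]_n * 'rV[R]_n) * R) :=
  dotp (grad f (q.1.1 + q.2 *: q.1.2)) q.1.2 -
    sigma * dotp (grad f q.1.1) q.1.2.
have h_cont : {for ((x, d), 0), continuous h}.
  have c1 : q.1.1 @[q --> (x, d, 0 : R)] --> x.
    by apply: (@cvg_comp _ _ _ fst fst); [exact: cvg_fst|exact: cvg_fst].
  have c2 : q.1.2 @[q --> (x, d, 0 : R)] --> d.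
    by apply: (@cvg_comp _ _ _ fst snd); [exact: cvg_fst|exact: cvg_snd].
  have c3 : q.2 @[q --> (x, d, 0 : R)] --> (0 : R) by exact: cvg_snd.
  apply: cvgB.
    apply: cvg_dotp => //; apply: continuous_cvg; first exact: grad_cont.
    by apply: cvgD => //; exact: cvgZ.
  apply: cvgM; first exact: cvg_cst.
  by apply: cvg_dotp => //; apply: continuous_cvg => //; exact: grad_cont.
(* h ((x, d), 0) is (1 - sigma) <grad f x, d>. *)
have h0 : h ((x, d), 0) < 0.
  by rewrite /h/= scale0r addr0; nra.
have : \forall q \near ((x, d), 0 : R), h q < 0.
  exact: (cvgr_lt _ h_cont).
case=> -[/= A B] [A_nbhs /nbhs_ballP[delta /= delta0 Bdelta]] AB.
exists delta => //.
apply: filterS A_nbhs => z Az s /andP[s0 s_delta].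
have slope_lt t : 0 < t < s ->
    dotp (grad f (z.1 + t *: z.2)) z.2 < sigma * dotp (grad f z.1) z.2.
  move=> /andP[t0 ts]; rewrite -subr_lt0; apply: (AB (z, t)); split => //=.
  by apply: Bdelta; rewrite /ball/= sub0r normrN gtr0_norm// (lt_trans ts).
have line_derive t := is_derive_line (f_diff (z.1 + t *: z.2)).
have [|t] := MVT s0 (fun t _ => line_derive t).
  apply: derivable_within_continuous => t _; exact: ex_derive.
rewrite in_itv/= scale0r addr0 subr0 => /slope_lt slope eq_f.
by have := eq_f; nra.
Qed.

(** * Cluster points along filters *)

(** The filter generated by F and by the preimages of the neighbourhoods of the
    cluster point. Refining the filter on the indices replaces the extraction of
    a subsequence: convergences already obtained along F are kept. *)
Lemma cluster_refine (I : Type) (T : topologicalType) (F : set_system I)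
    {FF : Filter F} (x : I -> T) (l : T) :
  cluster (x @ F) l ->
  exists G : set_system I, [/\ ProperFilter G, F `<=` G & x @ G --> l].
Proof.
move=> xFl; exists (fun A => exists2 V, nbhs l V & F [set i | V (x i) -> A i]).
split.
- apply: Build_ProperFilter_ex; last split.
  + move=> A [V lV FA]; apply: contrapT => noA.
    have FnV : F [set i | ~ V (x i)].
      by apply: filterS FA => i VA Vi; apply: noA; exists i; exact: VA.
    by have [y []] := xFl (~` V) V FnV lV.
  + by exists setT; [exact: filterT|apply: filterE].
  + move=> A B [V lV FA] [W lW FB]; exists (V `&` W); first exact: filterI.
    by apply: filterS2 FA FB => i VA WB [Vi Wi]; split; [exact: VA|exact: WB].
  + move=> A B AB [V lV FA]; exists V => //.
    by apply: filterS FA => i VA Vi; exact/AB/VA.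
- move=> A FA; exists setT; first exact: filterT.
  by apply: filterS FA => i Ai _.
- by move=> V lV; exists V => //; apply: filterE => i.
Qed.

(** * Inexact projections of a gradient step *)

(** What remains of an inexact projection of x - alpha g once the tolerance is
    replaced by its upper bound with coefficient 1 / 2. *)
Definition near_projection (R : realType) (n : nat) (C : set 'rV[R]_n)
    (g : 'rV[R]_n) (alpha : R) (x : 'rV[R]_n) : set 'rV[R]_n :=
  [set w | C w /\ forall y, C y ->
    - dotp (w - x) (y - w) - alpha * dotp g (y - w) <=
      2^-1 * dotp (w - x) (w - x)].

Section NearProjection.
Context {R : realType} {n : nat} (C : set 'rV[R]_n).
Context (g : 'rV[R]_n) (alpha : R) (x w : 'rV[R]_n).
Context (Cx : C x) (xw : near_projection C g alpha x w).

Lemma near_projection_descent :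
  alpha * dotp g (w - x) <= - (2^-1 * dotp (w - x) (w - x)).
Proof.
have [_ /(_ _ Cx)] := xw.
by rewrite -(opprB w x) !dotpNr; lra.
Qed.

(** From ||d||^2 <= - 2 alpha <g, d>, by expanding ||d + 2 alpha g||^2 >= 0. *)
Lemma near_projection_bounded :
  dotp (w - x) (w - x) <= 4 * alpha ^+ 2 * dotp g g.
Proof.
have := near_projection_descent; move: (w - x) => d descent.
have := dotp_ge0 (d + (2 * alpha) *: g).
rewrite !dotp_lin (dotpC d g); nra.
Qed.

(** The variational inequality at w with an error that vanishes with d and is
    free of alpha, so that it passes to the limit without convergence of the
    parameters alpha_k. *)
Lemma near_projection_vi (a : R) (y : 'rV[R]_n) : 0 < a <= alpha -> C y ->
  0 <= dotp g (y - w) +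
    (`|dotp (w - x) (y - w)| + 2^-1 * dotp (w - x) (w - x)) / a.
Proof.
move=> /andP[a0 a_alpha] Cy; have [_ /(_ _ Cy)] := xw.
set s := dotp _ (y - w); set r := dotp g _; set q := dotp (w - x) _ => vi.
have q0 : 0 <= q by exact: dotp_ge0.
set e := `|s| + 2^-1 * q.
have e0 : 0 <= e by rewrite addr_ge0// mulr_ge0// invr_ge0.
have re : - e <= alpha * r.
  by have := ler_norm s; rewrite /e; lra.
have [r0|r0] := leP 0 r; first by rewrite addr_ge0// divr_ge0// ltW.
rewrite -(pmulr_rge0 _ a0) mulrDr mulrCA divff ?gt_eqF// mulr1.
by nra.
Qed.

End NearProjection.

Lemma candidates_near_projection (R : realType) (n : nat) (C : set 'rV[R]_n)
    (f : 'rV[R]_n -> R) (phi : R -> 'rV[R]_n -> 'rV[R]_n -> R)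
    (p : ginexpm_params R) (alpha g : R) (x w : 'rV[R]_n) :
  error_tolerance phi -> valid_params p -> admissible p alpha g ->
  candidates C f phi alpha g x w -> near_projection C (grad f x) alpha x w.
Proof.
move=> [phi_le _] [_ _ _ _ gbar] [_ /andP[g0 g_gbar]] [Cw vi].
split=> // y Cy; have /andP[_] := phi_le g x w g0.
rewrite enorm_sqr; have := vi y Cy.
have -> : x - alpha *: grad f x - w = - (w - x) - alpha *: grad f x.
  by rewrite opprB addrAC.
rewrite (dotpDl (- (w - x))) (dotpNl (w - x)) (dotpNl (alpha *: _)) dotpZl.
have := dotp_ge0 (w - x).
nra.
Qed.

Lemma candidates_nonempty (R : realType) (n : nat) (C : set 'rV[R]_n)
    (f : 'rV[R]_n -> R) (phi : R -> 'rV[R]_n -> 'rV[R]_n -> R)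
    (alpha g : R) (x : 'rV[R]_n) :
  C !=set0 -> closed C -> @convex_set R 'rV[R]_n C -> error_tolerance phi ->
  0 <= g -> candidates C f phi alpha g x !=set0.
Proof.
move=> C0 Ccl Cconv [phi_tol _] g0.
have [w Cw wproj] := projection_exists (x - alpha *: grad f x) C0 Ccl Cconv.
exists w; split=> // y /wproj /le_trans; apply.
by have /andP[] := phi_tol g x w g0.
Qed.

(** * Iterations of the method *)

Section Run.
Context (R : realType) (n : nat) (C : set 'rV[R]_n) (f : 'rV[R]_n -> R)
  (phi : R -> 'rV[R]_n -> 'rV[R]_n -> R) (p : ginexpm_params R).
Context (C_closed : closed C) (C_convex : @convex_set R 'rV[R]_n C)
  (f_C1 : continuously_differentiable f)
  (phi_tol : error_tolerance phi) (p_valid : valid_params p).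

Lemma admissible_gt0 alpha g : admissible p alpha g -> 0 < alpha.
Proof. by case: p_valid => _ _ a0 _ _ [/andP[/(lt_le_trans a0)]]. Qed.

Lemma candidate_descent alpha g x w : C x -> admissible p alpha g ->
  candidates C f phi alpha g x w -> w <> x -> dotp (grad f x) (w - x) < 0.
Proof.
move=> Cx adm xw /eqP; rewrite -subr_eq0 => /dotp_gt0 d0.
have a0 := admissible_gt0 adm.
have xw_near := candidates_near_projection phi_tol p_valid adm xw.
have := near_projection_descent Cx xw_near.
move=> descent; rewrite -(pmulr_rlt0 _ a0); lra.
Qed.

Lemma candidate_fixed_stationary alpha g x : C x -> admissible p alpha g ->
  candidates C f phi alpha g x x -> stationary C f x.
Proof.
move=> Cx adm xx; split=> // y Cy.
have a0 := admissible_gt0 adm.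
have [_ /(_ _ Cy)] := candidates_near_projection phi_tol p_valid adm xx.
by rewrite subrr !dotp0 mulr0 oppr0 sub0r oppr_le0 pmulr_rge0.
Qed.

(** The point x itself lies in the neighbourhood given by [armijo_near], and
    tau^j gets below the threshold on the steps. *)
Lemma armijo_terminates alpha g x w : C x -> admissible p alpha g ->
  candidates C f phi alpha g x w -> w <> x ->
  exists j, armijo f (sigma p) (tau p) x w j.
Proof.
move=> Cx adm xw wx; have gd0 := candidate_descent Cx adm xw wx.
have [/andP[_ sigma1] /andP[tau0 tau1] _ _ _] := p_valid.
have [delta delta0 /nbhs_singleton/= small_steps] :=
  armijo_near f_C1 sigma1 gd0.
have tau_cvg : (fun j => tau p ^+ j) @ \oo --> 0.
  by apply: cvg_expr; rewrite gtr0_norm.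
have [j _ /(_ j (leqnn j))] : \forall j \near \oo, tau p ^+ j < delta.
  exact: (cvgr_lt _ tau_cvg).
by exists j; apply: small_steps; rewrite exprn_gt0.
Qed.

Lemma step_feasible alpha g x w x' : C x ->
  ginexpm_step C f phi p alpha g x w x' -> C x'.
Proof.
have [_ /andP[tau0 tau1] _ _ _] := p_valid.
move=> Cx [_ [Cw _] _ [j _ ->]]; apply: convex_segment => //.
by rewrite exprn_ge0 ?exprn_ile1// ltW.
Qed.

Lemma step_decreases alpha g x w x' : C x ->
  ginexpm_step C f phi p alpha g x w x' -> f x' < f x.
Proof.
have [/andP[sigma0 _] /andP[tau0 tau1] _ _ _] := p_valid.
move=> Cx [adm xw wx [j [+ _] ->]] => /le_lt_trans; apply.
rewrite gtrDl pmulr_rlt0 ?(candidate_descent Cx adm xw)//.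
by rewrite mulr_gt0 ?exprn_gt0.
Qed.

(** If the search backtracks at all, the exponent before the accepted one was
    refused, so tau^(j - 1) >= delta. *)
Lemma armijo_index_large x w j delta :
  (forall s, 0 < s < delta ->
    f (x + s *: (w - x)) <= f x + sigma p * s * dotp (grad f x) (w - x)) ->
  armijo_index f (sigma p) (tau p) x w j ->
  Num.min 1 (tau p * delta) <= tau p ^+ j.
Proof.
have [_ /andP[tau0 tau1] _ _ _] := p_valid.
move=> small_steps [_].
case: j => [|j] jmin; first by rewrite expr0 ge_min lexx.
rewrite ge_min; apply/orP; right; rewrite exprS ler_pM2l// leNgt.
apply/negP => tau_j; have /jmin : armijo f (sigma p) (tau p) x w j.
  by apply: small_steps; rewrite exprn_gt0.
by rewrite ltnn.
Qed.

(** Only the first N steps are assumed, as a run that stops or breaks down at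
    iteration N says nothing about the later ones. *)
Lemma prefix_feasible (x w : nat -> 'rV[R]_n) (alpha gam : nat -> R) N :
  C (x 0%N) ->
  (forall k, (k < N)%N ->
    ginexpm_step C f phi p (alpha k) (gam k) (x k) (w k) (x k.+1)) ->
  C (x N).
Proof.
move=> x0_C; elim: N => // N IHN steps.
by apply: step_feasible (steps N _) => //; apply: IHN => k /ltnW; exact: steps.
Qed.

(** * Cluster points of an infinite run *)

Section InfiniteRun.
Context (x w : nat -> 'rV[R]_n) (alpha gam : nat -> R) (x0_C : C (x 0%N))
  (steps : forall k,
    ginexpm_step C f phi p (alpha k) (gam k) (x k) (w k) (x k.+1)).

Let iterates_feasible k : C (x k).
Proof. by apply: (prefix_feasible x0_C) => i _; exact: steps. Qed.

Lemma values_decreasing : decreasing_seq (f \o x).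
Proof.
apply/decreasing_seqP => k.
by apply: step_decreases (steps k); exact: iterates_feasible.
Qed.

Let iterates_near_projection k :
  near_projection C (grad f (x k)) (alpha k) (x k) (w k).
Proof.
by have [adm xw _ _] := steps k; exact: candidates_near_projection adm xw.
Qed.

Let alpha_bounds k : alpha_min p <= alpha k <= alpha_max p.
Proof. by have [[]] := steps k. Qed.

(** A nonzero limit direction would be one of strict descent at xbar, along
    which the steps stay bounded below; f would then drop by a fixed amount at
    iterates whose values tend to f xbar, a lower bound of all values. *)
Lemma directions_vanish (U : set_system nat) {UF : ProperFilter U}
    (xbar dbar : 'rV[R]_n) :
  \oo `<=` U -> x @ U --> xbar -> (fun k => w k - x k) @ U --> dbar ->
  dbar = 0.
Proof.
move=> oo_U x_cvg d_cvg; apply: contrapT => /eqP dbar0.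
have [f_diff grad_cont] := f_C1.
have [/andP[sigma0 sigma1] /andP[tau0 tau1] amin0 amin_max _] := p_valid.
have g_cvg : grad f (x k) @[k --> U] --> grad f xbar.
  exact: continuous_cvg (grad_cont _) x_cvg.
have fx_cvg : f (x k) @[k --> U] --> f xbar.
  by apply: continuous_cvg x_cvg; exact: differentiable_continuous.
have gd_cvg : dotp (grad f (x k)) (w k - x k) @[k --> U] -->
    dotp (grad f xbar) dbar by exact: cvg_dotp.
(* As the slopes <grad f x^k, d^k> are negative, the descent inequality remains
   true with alpha_k replaced by alpha_max, and can then pass to the limit. *)
have gd0 : dotp (grad f xbar) dbar < 0.
  have amax0 : 0 < alpha_max p by exact: lt_le_trans amin_max.
  rewrite -(pmulr_rlt0 _ amax0).
  apply: (@le_lt_trans _ _ (- (2^-1 * dotp dbar dbar))); last first.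
    by rewrite oppr_lt0 mulr_gt0 ?dotp_gt0.
  apply: (ler_cvg_to
    (f := fun k => alpha_max p * dotp (grad f (x k)) (w k - x k))
    (g := fun k => - (2^-1 * dotp (w k - x k) (w k - x k))) (a := U)).
  - exact: cvgMl_tmp.
  - by apply: cvgN; apply: cvgMl_tmp; exact: cvg_dotp.
  apply: filterE => k.
  have [adm xw wx _] := steps k.
  have := candidate_descent (iterates_feasible k) adm xw wx.
  have := near_projection_descent (iterates_feasible k)
    (iterates_near_projection k).
  by have /andP[_] := alpha_bounds k; nra.
have [delta delta0 small_steps] := armijo_near f_C1 sigma1 gd0.
pose c := Num.min 1 (tau p * delta).
have c0 : 0 < c by rewrite lt_min ltr01 mulr_gt0.
have f_lb m : f xbar <= f (x m).
  apply: (cvgr_to_le fx_cvg); apply: oo_U; exists m => // k /= mk.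
  by rewrite values_decreasing.
suff : f xbar <= f xbar + sigma p * c * dotp (grad f xbar) dbar.
  by rewrite lerDl pmulr_rge0 ?mulr_gt0// leNgt gd0.
apply: (cvgr_to_ge (F := U)
  (f := fun k => f (x k) + sigma p * c * dotp (grad f (x k)) (w k - x k))).
  by apply: cvgD => //; exact: cvgMl_tmp.
have pair_cvg : (x k, w k - x k) @[k --> U] --> (xbar, dbar).
  exact: (cvg_pair x_cvg d_cvg).
have small_stepsU : \forall k \near U, forall s : R, 0 < s < delta ->
    f (x k + s *: (w k - x k)) <=
    f (x k) + sigma p * s * dotp (grad f (x k)) (w k - x k).
  exact: (pair_cvg _ small_steps).
apply: filterS small_stepsU => k armijo_k.
have [adm xw wx [j jidx x_next]] := steps k.
have gdk := candidate_descent (iterates_feasible k) adm xw wx.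
apply: le_trans (f_lb k.+1) _.
have [+ _] := jidx; rewrite /armijo -x_next => /le_trans; apply.
rewrite lerD2l ler_wnM2r ?(ltW gdk)// ler_wpM2l ?(ltW sigma0)//.
exact: armijo_index_large jidx.
Qed.

(** The directions are bounded near xbar, so along a finer filter they converge,
    to 0 by the previous lemma; the variational inequality at w^k then has the
    one at xbar as its limit. *)
Lemma cluster_stationary (xbar : 'rV[R]_n) :
  cluster (x @ \oo) xbar -> stationary C f xbar.
Proof.
move=> /cluster_refine [V [VF oo_V x_cvgV]].
have [f_diff grad_cont] := f_C1.
have [/andP[sigma0 sigma1] /andP[tau0 tau1] amin0 amin_max _] := p_valid.
(* The 1 leaves room for the gradients at x^k, which only tend to that at
   xbar. *)
pose M := 4 * alpha_max p ^+ 2 * (dotp (grad f xbar) (grad f xbar) + 1).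
have [dbar [_ /cluster_refine [U [UF V_U d_cvg]]]] :
    [set d | dotp (d - 0) (d - 0) <= M] `&`
      cluster ((fun k => w k - x k) @ V) !=set0.
  apply: (@compact_dotp_ball R n 0 M).
  have g_cvg : grad f (x k) @[k --> V] --> grad f xbar.
    exact: continuous_cvg (grad_cont _) x_cvgV.
  have : \forall k \near V, dotp (grad f (x k)) (grad f (x k)) <
      dotp (grad f xbar) (grad f xbar) + 1.
    by apply: (cvgr_lt _ (cvg_dotp g_cvg g_cvg)); rewrite ltrDl.
  apply: filterS => k /= /ltW gk; rewrite subr0.
  apply: le_trans (near_projection_bounded (iterates_feasible k)
    (iterates_near_projection k)) _.
  have /andP[amin_k amax_k] := alpha_bounds k.
  have ak0 : 0 <= alpha k by exact: le_trans (ltW amin0) amin_k.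
  apply: ler_pM => //; rewrite ?dotp_ge0 ?mulr_ge0 ?sqr_ge0//.
  by rewrite ler_pM2l// ler_pXn2r ?nnegrE// (le_trans ak0).
have oo_U : \oo `<=` U by exact: subset_trans V_U.
have x_cvg : x @ U --> xbar by move=> A /x_cvgV/V_U.
have dbar0 := directions_vanish oo_U x_cvg d_cvg.
rewrite {}dbar0 in d_cvg.
have g_cvg : grad f (x k) @[k --> U] --> grad f xbar.
  exact: continuous_cvg (grad_cont _) x_cvg.
have w_cvg : w @ U --> xbar.
  have -> : w = (fun k => (w k - x k) + x k)
    by apply/funext => k; rewrite subrK.
  by rewrite -[xbar]add0r; exact: cvgD.
split.
  apply: (closed_cvg _ C_closed _ _ x_cvg).
  by apply: filterE; exact: iterates_feasible.
move=> y Cy.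
have yw_cvg : (fun k => y - w k) @ U --> y - xbar.
  by apply: cvgB => //; exact: cvg_cst.
apply: (cvgr_to_ge (F := U) (f := fun k => dotp (grad f (x k)) (y - w k) +
  (`|dotp (w k - x k) (y - w k)| + 2^-1 * dotp (w k - x k) (w k - x k)) /
    alpha_min p)).
  have q_cvg : dotp (w k - x k) (w k - x k) @[k --> U] --> (0 : R).
    by rewrite -(@dotp0 R n 0); exact: cvg_dotp.
  have s_cvg : `|dotp (w k - x k) (y - w k)| @[k --> U] --> (0 : R).
    rewrite -(normr0 R) -(@dotp0 R n (y - xbar)).
    by apply: cvg_norm; exact: cvg_dotp.
  have e_cvg : `|dotp (w k - x k) (y - w k)| +
      2^-1 * dotp (w k - x k) (w k - x k) @[k --> U] --> 0 + 2^-1 * (0 : R).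
    by apply: cvgD => //; exact: cvgMl_tmp.
  have -> : dotp (grad f xbar) (y - xbar) =
      dotp (grad f xbar) (y - xbar) + (0 + 2^-1 * 0) / alpha_min p.
    by rewrite mulr0 addr0 mul0r addr0.
  by apply: cvgD; [exact: cvg_dotp|exact: cvgMr_tmp].
apply: filterE => k.
apply: near_projection_vi (iterates_near_projection k) _ _ _ _ => //.
by have /andP[-> _] := alpha_bounds k; rewrite amin0.
Qed.

End InfiniteRun.
End Run.

Theorem proposition19 (R : realType) (n : nat) (C : set 'rV[R]_n)
    (f : 'rV[R]_n -> R) (phi : R -> 'rV[R]_n -> 'rV[R]_n -> R)
    (p : ginexpm_params R) (x0 : 'rV[R]_n)
    (C_nonempty : C !=set0) (C_closed : closed C)
    (C_convex : @convex_set R 'rV[R]_n C)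
    (f_C1 : continuously_differentiable f)
    (phi_tol : error_tolerance phi)
    (p_valid : valid_params p) (x0_C : C x0)
    (o : outcome) (x : nat -> 'rV[R]_n) (alpha gam : nat -> R)
    (w : nat -> 'rV[R]_n)
    (run : ginexpm_run C f phi p x0 o x alpha gam w) :
  (exists2 N : nat, o = Finishes N & stationary C f (x N)) \/
  [/\ o = Infinite,
      decreasing_seq (fun k => f (x k)) &
      forall xbar : 'rV[R]_n,
        cluster (x @ \oo) xbar -> stationary C f xbar].
Proof.
case: run => x0E; have x_C : C (x 0%N) by rewrite x0E.
case: o => [N||N].
- move=> [steps adm wN_cand wN]; left; exists N => //.
  have xN_C := prefix_feasible C_convex p_valid x_C steps.
  rewrite wN in wN_cand.
  exact: (candidate_fixed_stationary phi_tol p_valid xN_C adm wN_cand).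
- move=> steps; right; split => //.
    exact: (values_decreasing C_convex phi_tol p_valid x_C steps).
  by move=> xbar; exact: (cluster_stationary C_closed C_convex f_C1 phi_tol
    p_valid x_C steps).
move=> [steps adm]; have xN_C := prefix_feasible C_convex p_valid x_C steps.
have [_ /andP[g0 _]] := adm.
case=> [no_candidate|[wN_cand wN no_exponent]].
  have := candidates_nonempty f (alpha N) (x N) C_nonempty C_closed C_convex
    phi_tol g0.
  by rewrite no_candidate => -[].
have [j] := armijo_terminates f_C1 phi_tol p_valid xN_C adm wN_cand wN.
by move=> /no_exponent.
Qed.
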